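(* Let $V=V(d,p)$ be a vector space of dimension $d$ over the field with $p$ elements, $p$ prime, with group of translations $N$, and let $G=N.G_0\leq\mathrm{AGL}(d,p)$ with $G_0\leq\mathrm{GL}(d,p)$, such that: (a) $G^V$ has rank $2$ or $3$; (b) there exists a $G_0$-orbit $\mathcal{M}=\{M_1,\ldots,M_r\}$ (with $r\geq3$) of subspaces of $V$ such that $G_0^{\mathcal{M}}$ is $2$-transitive (not necessarily faithful); (c) $V=M_1+M_2$; (d) the stabiliser $(G_0)_{M_1}$ acts transitively on $(V/M_1)^*$; (e) $\bigcup_{i=1}^r M_i^*$ is a $G_0$-orbit. Let $\mathcal{D}=(V,\bigcup_{i=1}^r V/M_i,\mathcal{I})$ be the design with point set $V$, with blocks all cosets of the subspaces $M_1,\dots,M_r$, and with incidence $\mathcal{I}$ given by inclusion, and let $\Gamma=\Gamma(\mathcal{D})$ be its incidence graph, with ordered bipartition $(V\,|\,\bigcup_{i=1}^r V/M_i)$. Then $\mathcal{D}$ and $\Gamma$ admit $G$ as an automorphism group, $\Gamma$ is connected, $1\neq N\lhd G$, and the following (equivalent) conditions hold: (1) $\Gamma$ is $r$-starlike relative to $N$, and $\Gamma$ is locally $(G,4)$-distance transitive; (2) $\mathcal{D}=\mathcal{D}(\Gamma)$ is $G$-pairwise transitive and $N$-nicely affine with $r$ parallel classes of blocks.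
   Context: All graphs are finite, simple and without loops. $X^*$ denotes the set of non-zero elements of a vector space $X$: $M^*=M\setminus\{0\}$ and $(V/M)^*=\{v+M\mid v\in V\setminus M\}$. $G^X$ denotes the permutation group induced by $G$ on $X$. The rank of a transitive permutation group is the number of orbits of a point stabiliser. $N$ is the group of all translations of $V$, and $G_0$ is the stabiliser in $G$ of the zero vector. $G$ acts on $V$ by affine transformations and on cosets of the $M_i$ in the induced way. A design $(\mathcal{P},\mathcal{B},\mathcal{I})$ consists of a point set, a block set and an incidence relation $\mathcal{I}\subseteq\mathcal{P}\times\mathcal{B}$; its incidence graph is the bipartite graph with ordered bipartition $(\mathcal{P}|\mathcal{B})$ and adjacency given by incidence. An automorphism of a design is a permutation of $\mathcal{P}\cup\mathcal{B}$ preserving points, blocks and incidence. For a bipartite graph $\Gamma$ with ordered bipartition $(B|B')$ the adjacency design $\mathcal{D}(\Gamma)$ has point set $B$, block set $B'$ and incidence given by adjacency. Two distinct points are collinear if incident with at least one common block, otherwise non-collinear; two distinct blocks are intersecting if incident with at least one common point, otherwise non-intersecting. Locally $(G,s)$-distance transitive: the graph has diameter at least $s$, $G$ is a group of automorphisms, and for each vertex $v$ and each $1\leq i\leq s$ the stabiliser $G_v$ is transitive on the set of vertices at distance $i$ from $v$. $r$-starlike: a connected bipartite graph with ordered bipartition $(B|B')$ is $r$-starlike relative to a group $N$ of automorphisms if $r\geq2$, $N$ is transitive on $B$, and $N$ has exactly $r$ orbits on $B'$. $G$-pairwise transitive: $G$ is a group of automorphisms transitive on each of the following six (possibly empty) sets: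 incident and non-incident point-block pairs, collinear and non-collinear point pairs, intersecting and non-intersecting block pairs (ordered pairs of distinct elements). $N$-nicely affine: $N$ is a group of automorphisms transitive on points, and there is a constant $\mu$ such that distinct blocks are incident with exactly $\mu$ common points if they are in different $N$-orbits and with no common point if they are in the same $N$-orbit. The $N$-orbits on blocks are the parallel classes. *)

(* Defs.v *)
From HB Require Import structures.
From mathcomp Require Import all_boot all_algebra all_fingroup.
From mathcomp Require Import primitive_action.

Set Implicit Arguments.
Unset Strict Implicit.
Unset Printing Implicit Defensive.

Import GRing.Theory.

(* The actions of MathComp are partial: an [action D T] is only meaningful for
   elements of its domain [D], so every notion of a group [G] of automorphisms
   below records [G \subset D]. *)

(** * Permutation groups *)

Definition has_rank (T : finType) (G : {set {perm T}}) (k : nat) : Prop :=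
  [transitive G, on [set: T] | 'P] /\
  forall x : T, #|orbit 'P 'C_G[x | 'P] @: [set: T]| = k.

(* Unlike [transitive G, on S | to], this holds when [S] is empty. *)
Definition transitive_on_set (aT : finGroupType) (D : {set aT}) (T : finType)
    (to : action D T) (G : {set aT}) (S : pred T) : Prop :=
  forall x y, S x -> S y -> exists2 g, g \in G & to x g = y.

(* [G] is transitive on the (possibly empty) set of pairs [(f i, h j)] with
   [R i j]. *)
Definition transitive_on_pairs (aT : finGroupType) (D : {set aT}) (T : finType)
    (to : action D T) (G : {set aT}) (I J : finType)
    (f : I -> T) (h : J -> T) (R : I -> J -> bool) : Prop :=
  forall i j i' j', R i j -> R i' j' ->
    exists2 g, g \in G & to (f i) g = f i' /\ to (h j) g = h j'.

Section SumAction.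
Variables (aT : finGroupType) (D : {group aT}) (T1 T2 : finType).
Variables (to1 : action D T1) (to2 : action D T2).

Definition sum_act (x : T1 + T2) (a : aT) : T1 + T2 :=
  match x with inl x1 => inl (to1 x1 a) | inr x2 => inr (to2 x2 a) end.

Lemma sum_act_is_action : is_action D sum_act.
Proof.
split=> [a [x|x] [y|y] //= [] /act_inj -> // | [x|x] a b Da Db /=].
  by rewrite actMin.
by rewrite actMin.
Qed.

Definition sum_action : action D (T1 + T2)%type := Action sum_act_is_action.
End SumAction.

(** * Graphs *)

Section Graphs.
Variables (T : finType) (e : rel T).

Definition connected_graph : Prop := forall x y, connect e x y.

Definition walk (k : nat) (x y : T) : bool :=
  [exists w : k.-tuple T, path e x w && (last x w == y)].

Definition at_distance (k : nat) (x y : T) : bool :=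
  walk k x y && [forall j : 'I_k, ~~ walk j x y].

(* The distance of two vertices that are joined by no walk is infinite. *)
Definition diameter_geq (s : nat) : Prop :=
  exists x y, forall j, (j < s)%N -> ~~ walk j x y.

Variables (aT : finGroupType) (D : {set aT}) (to : action D T).

Definition graph_automorphism_group (G : {set aT}) : Prop :=
  [/\ G \subset D,
      [faithful G, on [set: T] | to] &
      forall g x y, g \in G -> e (to x g) (to y g) = e x y].

Definition locally_distance_transitive (G : {set aT}) (s : nat) : Prop :=
  [/\ diameter_geq s,
      graph_automorphism_group G &
      forall (v : T) (i : nat), (1 <= i <= s)%N ->
        transitive_on_set to 'C_G[v | to]%g (at_distance i v)].

End Graphs.

(** * Bipartite graphs with ordered bipartition *)

Definition in_left (A B : Type) (x : A + B) : bool :=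
  if x is inl _ then true else false.

Record bigraph := BiGraph {
  lpart : finType;
  rpart : finType;
  edge : rel (lpart + rpart);
  edge_sym : symmetric edge;
  edge_bip : forall x y, edge x y -> in_left x != in_left y
}.

Definition vertex (Gm : bigraph) : finType := (lpart Gm + rpart Gm)%type.

Definition left_vertices (Gm : bigraph) : {set vertex Gm} :=
  [set inl x | x : lpart Gm].
Definition right_vertices (Gm : bigraph) : {set vertex Gm} :=
  [set inr y | y : rpart Gm].

Definition starlike (Gm : bigraph) (aT : finGroupType) (D : {set aT})
    (to : action D (vertex Gm)) (N : {set aT}) (r : nat) : Prop :=
  [/\ connected_graph (@edge Gm),
      graph_automorphism_group (@edge Gm) to N,
      (2 <= r)%N,
      [transitive N, on left_vertices Gm | to] &
      #|orbit to N @: right_vertices Gm| = r].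

(** * Designs *)

Record design := Design {
  point : finType;
  block : finType;
  incident : point -> block -> bool
}.

Definition incidence_edge (P B : finType) (inc : P -> B -> bool) : rel (P + B) :=
  fun x y => match x, y with
    | inl p, inr b => inc p b
    | inr b, inl p => inc p b
    | _, _ => false
    end.

Lemma incidence_edge_sym (P B : finType) (inc : P -> B -> bool) :
  symmetric (incidence_edge inc).
Proof. by move=> [x|x] [y|y]. Qed.

Lemma incidence_edge_bip (P B : finType) (inc : P -> B -> bool) x y :
  incidence_edge inc x y -> in_left x != in_left y.
Proof. by case: x y => [x|x] [y|y]. Qed.

Definition incidence_graph (Ds : design) : bigraph :=
  BiGraph (incidence_edge_sym (@incident Ds))
          (incidence_edge_bip (inc := @incident Ds)).

Definition adjacency_design (Gm : bigraph) : design :=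
  Design (fun (x : lpart Gm) (y : rpart Gm) => edge (inl x) (inr y)).

Section DesignNotions.
Variable Ds : design.
Local Notation P := (point Ds).
Local Notation B := (block Ds).

Definition collinear (p q : P) : bool :=
  (p != q) && [exists b : B, incident p b && incident q b].
Definition noncollinear (p q : P) : bool :=
  (p != q) && ~~ [exists b : B, incident p b && incident q b].
Definition intersecting (b c : B) : bool :=
  (b != c) && [exists p : P, incident p b && incident p c].
Definition nonintersecting (b c : B) : bool :=
  (b != c) && ~~ [exists p : P, incident p b && incident p c].

Variables (aT : finGroupType) (D : {set aT}) (to : action D (P + B)%type).

Definition design_automorphism_group (G : {set aT}) : Prop :=
  [/\ G \subset D,
      [faithful G, on [set: P + B] | to],
      forall g x, g \in G -> in_left (to x g) = in_left x &
      forall g p b p' b', g \in G ->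
        to (inl p) g = inl p' -> to (inr b) g = inr b' ->
        incident p' b' = incident p b].

Definition pairwise_transitive (G : {set aT}) : Prop :=
  design_automorphism_group G /\
  [/\ transitive_on_pairs to G inl inr (@incident Ds),
      transitive_on_pairs to G inl inr (fun (p : P) (b : B) => ~~ incident p b),
      transitive_on_pairs to G inl inl collinear &
      transitive_on_pairs to G inl inl noncollinear] /\
  transitive_on_pairs to G inr inr intersecting /\
  transitive_on_pairs to G inr inr nonintersecting.

Definition parallel (N : {set aT}) (b c : B) : bool :=
  inr c \in orbit to N (inr b).

Definition parallel_classes (N : {set aT}) : {set {set P + B}} :=
  orbit to N @: [set inr b | b : B].

Definition nicely_affine (N : {set aT}) : Prop :=
  [/\ design_automorphism_group N,
      [transitive N, on [set inl p | p : P] | to] &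
      exists mu : nat, forall b c : B, b != c ->
        #|[set p : P | incident p b && incident p c]|
        = if parallel N b c then 0%N else mu].

End DesignNotions.

(** * The affine setting *)

Section Affine.
Variables (F : finFieldType) (d : nat).
Local Notation V := 'rV[F]_d.
Local Open Scope ring_scope.

Definition translation (v : V) : {perm V} := perm (@addrI V v).

Definition translations : {set {perm V}} := [set translation v | v : V].

Lemma translations_group_set : group_set translations.
Proof.
apply/group_setP; split.
  by apply/imsetP; exists 0 => //; apply/permP=> x; rewrite perm1 permE add0r.
move=> _ _ /imsetP[u _ ->] /imsetP[v _ ->]; apply/imsetP; exists (v + u) => //.
by apply/permP=> x; rewrite permM !permE addrA.
Qed.

Canonical translations_group : {group {perm V}} := Group translations_group_set.

(* [G0] is a subgroup of GL(V), viewed as a group of permutations of [V]. *)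
Definition linear_group (G0 : {set {perm V}}) : Prop :=
  forall g : {perm V}, g \in G0 -> linear g.

Definition vset (U : {vspace V}) : {set V} := [set v | v \in U].
Definition nonzero (U : {vspace V}) : {set V} := [set v in U | v != 0].

Definition coset_of_space (U : {vspace V}) (v : V) : {set V} :=
  [set v + u | u in vset U].

Definition quot (U : {vspace V}) : {set {set V}} :=
  [set coset_of_space U v | v : V].
Definition nonzero_quot (U : {vspace V}) : {set {set V}} :=
  [set coset_of_space U v | v in ~: vset U].

Variables (r : nat) (M : 'I_r -> {vspace V}).

Definition space_family : {set {set V}} := [set vset (M i) | i : 'I_r].

Definition all_cosets : {set {set V}} := \bigcup_(i < r) quot (M i).

Definition coset_block : finType := {B : {set V} | B \in all_cosets}.

Definition coset_design : design :=
  Design (fun (v : V) (B : coset_block) => v \in val B).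

(* The action of permutations of [V] on points and blocks; its domain is the
   setwise stabiliser of [all_cosets] in Sym(V). *)
Definition coset_dom : {group {perm V}} :=
  [group of subact_dom (fun B => B \in all_cosets) 'P^*].

Definition coset_design_action :
    action coset_dom (point coset_design + block coset_design)%type :=
  sum_action ('P \ subsetT coset_dom) (('P^*)^? : action coset_dom coset_block).

End Affine.

(* Main.v *)
(* An affine map x |-> b + g (x - a) with g in G0 moves any base point a to any
   base point b, so transitivity of G on pairs reduces to facts about G0 at the
   origin: (b) moves one or two of the M_i, (d) handles a block and a point or
   parallel block off it, (e) handles collinear points, and the rank bound leaves
   a single G0-orbit for the points outside the union of the M_i. Since
   M_i + M_j = V for i <> j by (c) and 2-transitivity, non-parallel blocks always
   meet, so non-intersecting means parallel, and these pair relations determine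
   all distances up to 4 in the incidence graph. *)
Require Import Defs.
From mathcomp Require Import all_boot all_algebra all_fingroup.
From mathcomp Require Import primitive_action.

Set Implicit Arguments.
Unset Strict Implicit.
Unset Printing Implicit Defensive.

Import GRing.Theory.

(** * Walks unrolled edge by edge *)

Section Walks.
Variables (T : finType) (e : rel T).

Lemma walk0 x y : walk e 0 x y = (x == y).
Proof.
apply/existsP/eqP => [[w]|->]; first by rewrite tuple0 /= => /eqP.
by exists [tuple] => /=.
Qed.

Lemma walkS k x y :
  walk e k.+1 x y = [exists z, e x z && walk e k z y].
Proof.
apply/existsP/existsP => [[w]|[z /andP[exz /existsP[w Pw]]]].
  case/tupleP: w => z w /= /andP[/andP[exz Pw] lw]; exists z.
  by rewrite exz; apply/existsP; exists w; rewrite Pw.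
by exists (cons_tuple z w); rewrite /= exz.
Qed.

End Walks.

(** * From the pair relations of a design to distances in its incidence graph *)

Section PairwiseTransitiveDesigns.
Variables (Ds : design) (aT : finGroupType) (D : {set aT}).
Variables (to : action D (point Ds + block Ds)%type) (G : {group aT}).
Let Gamma := incidence_graph Ds.

Lemma incidence_graph_automorphism_group :
  design_automorphism_group to G ->
  graph_automorphism_group (@edge Gamma) to G.
Proof.
case=> sGD faithG sideG incG; split=> // g x y Gg.
move: (sideG g x Gg) (sideG g y Gg).
case Ex: (to x g) => [v'|b']; case Ey: (to y g) => [w'|c'];
  case: x y Ex Ey => [v|b] [w|c] //= Ex Ey _ _.
  exact: incG Gg Ex Ey.
exact: incG Gg Ey Ex.
Qed.

(** Every edge switches sides. Hence each choice of sides leaves only two candidate distances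
    between 1 and 4. *)
Lemma walk_parity k (x y : vertex Gamma) :
  walk (@edge Gamma) k x y -> odd k = (in_left x != in_left y).
Proof.
elim: k x => [|k IHk] x; first by rewrite walk0 => /eqP->; rewrite eqxx.
rewrite walkS => /existsP[z /andP[/edge_bip xz /IHk /= ->]].
by case: (in_left x) (in_left y) (in_left z) xz => [] [] [].
Qed.

(** Used contrapositively: beyond distance 2 there is no common neighbour. Both edges leave the end
    vertices, matching the shape of collinearity and intersection. *)
Lemma walk2_common (x y : vertex Gamma) :
  (exists2 z, edge x z & edge y z) -> walk (@edge Gamma) 2 x y.
Proof.
case=> z xz yz; rewrite walkS; apply/existsP; exists z; rewrite xz walkS.
by apply/existsP; exists y; rewrite walk0 eqxx edge_sym yz.
Qed.

(** Meant for [i] from 1 to 4 of the parity forced by the sides, so the [else] branches stand for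
    distance 4 on equal sides and 3 on opposite sides. *)
Definition distance_relation (i : nat) (x y : vertex Gamma) : bool :=
  match x, y with
  | inl v, inl w => if i == 2 then collinear v w else noncollinear v w
  | inr b, inr c => if i == 2 then intersecting b c else nonintersecting b c
  | inl v, inr b | inr b, inl v =>
      if i == 1%N then incident v b else ~~ incident v b
  end.

(** Minimality does the work: at distance 3 an edge would be a shorter walk, and at distance 4 a
    common neighbour would give one. *)
Lemma at_distance_relation i (x y : vertex Gamma) :
  (1 <= i <= 4)%N -> at_distance (@edge Gamma) i x y ->
  (odd i = (in_left x != in_left y)) /\ distance_relation i x y.
Proof.
move=> i14 /andP[xy /forallP short]; split; first exact: walk_parity.
have {}short j : (j < i)%N -> ~~ walk (@edge Gamma) j x y.
  by move=> lt_ji; apply: (short (Ordinal lt_ji)).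
have ne_xy : x != y.
  by rewrite -(walk0 (@edge Gamma)); apply: short; case/andP: i14.
have par := walk_parity xy.
have Ei : [\/ i = 1%N, i = 2, i = 3 | i = 4].
  by case: i i14 {xy short par} => [|[|[|[|[|i]]]]] // _;
     [constructor 1|constructor 2|constructor 3|constructor 4].
have adj : i = 1%N -> edge x y.
  move=> Ei1; move: xy; rewrite Ei1 walkS => /existsP[z /andP[xz]].
  by rewrite walk0 => /eqP<-.
have nadj : (1 < i)%N -> ~~ edge x y.
  move=> lt1i; apply: contra (short 1%N lt1i) => exy.
  by rewrite walkS; apply/existsP; exists y; rewrite exy walk0 eqxx.
have mid : i = 2 -> exists2 z, edge x z & edge y z.
  move=> Ei2; move: xy; rewrite Ei2 walkS => /existsP[z /andP[xz]].
  rewrite walkS => /existsP[t /andP[zt]]; rewrite walk0 => /eqP Et.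
  by exists z; rewrite // edge_sym -Et.
have nmid : (2 < i)%N -> ~ exists2 z, edge x z & edge y z.
  by move=> lt2i /walk2_common; apply/negP/short.
(* Parity keeps [i = 2] and [i = 4] for vertices on the same side, [i = 1] and [i = 3] otherwise. *)
case: x y {xy short} ne_xy par adj nadj mid nmid =>
  [v|b] [w|c] /= ne par adj nadj mid nmid.
- rewrite /collinear /noncollinear; have -> /= : v != w by apply: contra ne => /eqP->.
  case: Ei par mid nmid => -> //= _ mid nmid.
    by case: (mid erefl) => [[?|b]] //= vb wb; apply/existsP; exists b; apply/andP.
  apply/existsP=> [[b /andP[vb wb]]]; apply: nmid => //; by exists (inr b).
- by case: Ei par adj nadj => -> //= _ adj nadj; [apply: adj|apply: nadj].
- by case: Ei par adj nadj => -> //= _ adj nadj; [apply: adj|apply: nadj].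
rewrite /intersecting /nonintersecting; have -> /= : b != c by apply: contra ne => /eqP->.
case: Ei par mid nmid => -> //= _ mid nmid.
  by case: (mid erefl) => [[v|?]] //= vb wb; apply/existsP; exists v; apply/andP.
apply/existsP=> [[v /andP[vb wb]]]; apply: nmid => //; by exists (inl v).
Qed.

(* For vertices on given sides, each distance from 1 to 4 falls within a single
   one of the six pair relations. *)
Lemma pairwise_locally_distance_transitive :
  pairwise_transitive to G -> diameter_geq (@edge Gamma) 4 ->
  locally_distance_transitive (@edge Gamma) to G 4.
Proof.
case=> autG [[tI tNI tC tNC] [tX tNX]] diam.
have grG := incidence_graph_automorphism_group autG.
split=> // v i i14 x y /(at_distance_relation i14)[pvx rvx].
case/(at_distance_relation i14)=> pvy rvy.
suff [g Gg [gv gx]] : exists2 g, g \in G & to v g = v /\ to x g = y.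
  exists g => //; case: autG => sGD _ _ _.
  by rewrite !inE (subsetP sGD) // Gg sub1set inE gv eqxx.
have {i14} : in_left x = in_left y.
  by move: pvx; rewrite pvy; case: (in_left v) (in_left x) (in_left y) => [] [] [].
case: v x y {pvx pvy} rvx rvy => [v|b] [w|c] [w'|c'] //=; case: ifP => _ R1 R2 _.
- exact: tC.
- exact: tNC.
- exact: tI.
- exact: tNI.
- by case: (tI _ _ _ _ R1 R2) => g Gg []; exists g.
- by case: (tNI _ _ _ _ R1 R2) => g Gg []; exists g.
- exact: tX.
exact: tNX.
Qed.

End PairwiseTransitiveDesigns.

(** * Affine maps and their effect on cosets *)

Section AffineMaps.
Variables (F : finFieldType) (d : nat).
Local Notation V := 'rV[F]_d.
Local Open Scope ring_scope.
Implicit Types (U W : {vspace V}) (u v w a b : V) (g : {perm V}).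

(** As [g] is a bijection, this means that [g] carries [U] onto [W]; the membership form serves
    directly as a rewrite rule. *)
Definition maps_space g U W : Prop := forall v, (g v \in W) = (v \in U).

Lemma maps_spaceP g U W : 'P^*%act (vset U) g = vset W -> maps_space g U W.
Proof.
move=> gU v; have := mem_imset (mem (vset U)) v (@perm_inj _ g).
by rewrite (_ : g @: _ = 'P^*%act (vset U) g) // gU !inE.
Qed.

Lemma maps_space_comp g h (U W X : {vspace V}) :
  maps_space g U W -> maps_space h W X -> maps_space (g * h)%g U X.
Proof. by move=> gUW hWX v; rewrite permM hWX. Qed.

Lemma mem_coset_of_space U v w : (w \in coset_of_space U v) = (w - v \in U).
Proof.
apply/imsetP/idP => [[u]|Uwv]; first by rewrite inE => Uu ->; rewrite addrC addKr.
by exists (w - v); rewrite ?inE // addrC subrK.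
Qed.

Lemma coset_of_space_eqP U v w :
  reflect (coset_of_space U v = coset_of_space U w) (v - w \in U).
Proof.
apply: (iffP idP) => [Uvw|eq_vw]; last first.
  by rewrite -mem_coset_of_space -eq_vw mem_coset_of_space subrr mem0v.
apply/setP=> x; rewrite !mem_coset_of_space.
have -> : x - w = (x - v) + (v - w) by rewrite addrA subrK.
by rewrite [RHS]rpredDr.
Qed.

Definition affine_perm g a b : {perm V} :=
  (translation (- a) * g * translation b)%g.

Lemma affine_permE g a b v : affine_perm g a b v = b + g (v - a).
Proof. by rewrite !permM !permE addrC [v - a]addrC addrC. Qed.

Lemma affine_perm_coset g a b U W v : linear g -> maps_space g U W ->
  affine_perm g a b @: coset_of_space U v = coset_of_space W (b + g (v - a)).
Proof.
move=> lin_g gUW; apply/setP=> y; rewrite -(permKV (affine_perm g a b) y).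
set x := _ y; rewrite mem_imset; last exact: perm_inj.
rewrite !mem_coset_of_space affine_permE.
rewrite opprD addrACA subrr add0r.
rewrite -(zmod_morphism_linear lin_g).
by rewrite gUW opprB addrA subrK.
Qed.

End AffineMaps.

(** * The affine group [G], its translations and the stabiliser of the origin *)

Section CosetDesign.
Variables (F : finFieldType) (d r : nat).
Local Notation V := 'rV[F]_d.
Local Open Scope ring_scope.
Variables (G0 G : {group {perm V}}) (M : 'I_r -> {vspace V}).
Hypothesis G0_linear : linear_group G0.
Hypothesis G_def : G :=: (translations F d * G0)%g.
Implicit Types (i j k l : 'I_r) (u v w a b : V) (g h : {perm V}).
Local Notation N := (translations_group F d).
Local Notation Ds := (coset_design M).
Local Notation to := (coset_design_action M).

Lemma G0_sub_G : G0 \subset G.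
Proof. by rewrite G_def mulG_subr. Qed.

Lemma translations_sub_G : N \subset G.
Proof. by rewrite G_def mulG_subl. Qed.

Lemma translation_in v : translation v \in N.
Proof. exact: imset_f. Qed.

Lemma affine_perm_in g a b : g \in G0 -> affine_perm g a b \in G.
Proof.
have tG v : translation v \in G.
  by apply: (subsetP translations_sub_G); apply: translation_in.
by move=> G0g; rewrite /affine_perm !groupM ?tG // (subsetP G0_sub_G).
Qed.

Lemma linear_perm0 g : g \in G0 -> g 0 = 0.
Proof.
move=> /G0_linear lin_g.
by rewrite -[0 in LHS](subrr 0) (zmod_morphism_linear lin_g) subrr.
Qed.

(** The translation by [u] followed by [h] is [x |-> h (x - (- u))], so the target base point 0
    suffices. *)
Lemma affine_permP g :
  g \in G -> exists u, exists2 h, h \in G0 & g = affine_perm h u 0.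
Proof.
rewrite G_def => /mulsgP[_ h /imsetP[u _ ->] G0h ->]; exists (- u), h => //.
apply/permP=> v; rewrite affine_permE permM permE add0r.
by rewrite opprK addrC.
Qed.

(** If [x |-> h (x - u)] fixes 0, then [h (- u) = 0] and so [u = 0]. This lets the rank of [G] be
    read as a statement about orbits of [G0]. *)
Lemma stab0_linear g : g \in 'C_G[0 | 'P]%g -> g \in G0.
Proof.
rewrite inE => /andP[/affine_permP[u [h G0h ->]] /astab1P /=].
rewrite apermE affine_permE !add0r => h_u0; suff -> : affine_perm h u 0 = h by [].
have u0 : u = 0.
  by apply: oppr_inj; apply: (@perm_inj _ h); rewrite h_u0 oppr0 linear_perm0.
by apply/permP=> v; rewrite affine_permE u0 subr0 add0r.
Qed.

(** Conjugating the translation by [v] with a map of linear part [h] gives the translation by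
    [h v]. *)
Lemma translations_normal : (N <| G)%g.
Proof.
rewrite /normal translations_sub_G; apply/subsetP=> g /affine_permP[u [h G0h Eg]].
rewrite inE; apply/subsetP=> _ /imsetP[_ /imsetP[v _ ->] ->].
suff -> : (translation v ^ g = translation (h v))%g by apply: translation_in.
apply/permP=> x; rewrite -(permKV g x); set y := _ x.
rewrite permJ [translation v _]permE [translation (h v) _]permE Eg !affine_permE !add0r.
rewrite -addrA; apply/eqP; rewrite -subr_eq.
by rewrite -(zmod_morphism_linear (G0_linear G0h)) addrK.
Qed.

(** * Blocks as cosets with a representative, and the action on them *)

Lemma coset_in_all_cosets i v : coset_of_space (M i) v \in all_cosets M.
Proof. by apply/bigcupP; exists i => //; apply: imset_f. Qed.

Definition coset_at i v : coset_block M :=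
  exist (fun B => B \in all_cosets M) _ (coset_in_all_cosets i v).

Lemma coset_at_surj (B : coset_block M) : exists i v, B = coset_at i v.
Proof.
have /bigcupP[i _ /imsetP[v _ EB]] := valP B.
by exists i, v; apply: val_inj.
Qed.

Lemma incident_coset_at i v w : @incident Ds w (coset_at i v) = (w - v \in M i).
Proof. exact: mem_coset_of_space. Qed.

Lemma coset_at_eqP i v w :
  reflect (coset_at i v = coset_at i w) (v - w \in M i).
Proof.
apply: (iffP (coset_of_space_eqP _ _ _)) => [? | /(congr1 val) //].
exact: val_inj.
Qed.

(** Any incident point can become the representative, so a common point can serve as base point for
    several blocks at once. *)
Lemma coset_at_incident i v w :
  @incident Ds w (coset_at i v) -> coset_at i v = coset_at i w.
Proof.
by rewrite incident_coset_at => Miwv; apply/coset_at_eqP; rewrite -memvN opprB.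
Qed.

Lemma act_point g v : to (inl v) g = inl (g v).
Proof. by []. Qed.

(** Outside its domain the induced action on blocks is trivial, so images can be computed only once
    [g] is known to lie in [coset_dom M]. *)
Lemma act_block g (B C : coset_block M) :
  g \in coset_dom M -> g @: val B = val C -> to (inr B) g = inr C.
Proof.
move=> dom_g gB; congr inr; apply: val_inj; rewrite val_subact.
by rewrite [g \in _]dom_g -gB.
Qed.

Lemma act_val g (B : coset_block M) : g \in coset_dom M ->
  exists2 C, to (inr B) g = inr C & g @: val B = val C.
Proof.
move=> dom_g; eexists; first by [].
by rewrite val_subact [g \in _]dom_g.
Qed.

Lemma design_action_automorphisms (H : {group {perm V}}) :
  H \subset coset_dom M -> design_automorphism_group to H.
Proof.
move=> sHdom; split=> //.
(* Faithfulness already holds on points, where [g] acts as itself. *)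
- apply/subsetP=> g /setIP[_ fix_g]; rewrite inE; apply/eqP/permP=> v.
  by have [] := astab_act fix_g (in_setT (inl v)); rewrite perm1.
- by move=> g [v|B].
move=> g v B v' B' Hg; rewrite act_point => [[<-]].
have [C -> gB] := act_val B (subsetP sHdom g Hg); move=> [<-] /=.
by rewrite -gB mem_imset //; apply: perm_inj.
Qed.

Lemma mem_coset_dom g :
  (forall B : coset_block M, g @: val B \in all_cosets M) -> g \in coset_dom M.
Proof.
move=> stab_g; rewrite inE in_setT inE; apply/subsetP=> B.
by rewrite !inE => BM; apply: stab_g (exist _ B BM).
Qed.

Lemma translation_coset u i v :
  translation u @: val (coset_at i v) = val (coset_at i (u + v)).
Proof.
apply/setP=> y; rewrite -(permKV (translation u) y); set x := _ y.
rewrite mem_imset; last exact: perm_inj.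
by rewrite permE !mem_coset_of_space opprD addrACA subrr add0r.
Qed.

Lemma translations_sub_dom : N \subset coset_dom M.
Proof.
apply/subsetP=> _ /imsetP[u _ ->]; apply: mem_coset_dom => B.
have [i [v ->]] := coset_at_surj B; rewrite translation_coset; exact: valP.
Qed.

Lemma act_translation u i v :
  to (inr (coset_at i v)) (translation u) = inr (coset_at i (u + v)).
Proof.
apply: act_block; last exact: translation_coset.
exact: (subsetP translations_sub_dom) (translation_in u).
Qed.

(** * Parallel classes under translations *)

Hypothesis M_inj : injective M.

Lemma vset_M_inj : injective (fun i => vset (M i)).
Proof.
move=> i j /setP eqM; apply: M_inj; apply/vspaceP=> v.
by have := eqM v; rewrite !inE.
Qed.

(** Translating a block back by one of its points recovers its direction subspace, and [M_inj] then
    recovers the index. *)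
Lemma coset_at_inj i j v w : coset_at i v = coset_at j w -> i = j.
Proof.
move=> eq_ij; have : @incident Ds w (coset_at i v).
  by rewrite eq_ij incident_coset_at subrr mem0v.
move/coset_at_incident; rewrite eq_ij => /(congr1 val) /= eqB.
apply: vset_M_inj; apply/setP=> x; rewrite !inE -[x](addrK w).
by rewrite -!mem_coset_of_space eqB.
Qed.

(** Translations preserve directions, and the translation by [w - v] joins two blocks of the same
    direction. *)
Lemma parallel_coset_at i j v w :
  parallel to N (coset_at i v) (coset_at j w) = (i == j).
Proof.
apply/imsetP/eqP => [[_ /imsetP[u _ ->]]|<-].
  rewrite act_translation => -[E]; apply: (@coset_at_inj _ _ (u + v) w).
  exact/esym/val_inj.
exists (translation (w - v)); first exact: translation_in.
by rewrite act_translation subrK.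
Qed.

(** The blocks through the origin, one for each direction, represent the classes. *)
Lemma card_parallel_classes : #|parallel_classes to N| = r.
Proof.
pose f i := orbit to N (inr (coset_at i 0)).
have f_inj : injective f.
  move=> i j eq_f; apply/eqP; rewrite -(parallel_coset_at i j 0 0).
  by rewrite /parallel -/(f i) eq_f orbit_refl.
rewrite -[RHS]card_ord -(card_imset predT f_inj); apply: eq_card => X.
apply/imsetP/imsetP => [[_ /imsetP[B _ ->] ->] | [i _ ->]].
  have [i [v ->]] := coset_at_surj B; exists i => //; apply/esym/orbit_in_eqP.
    exact: translations_sub_dom.
  by rewrite -/(parallel _ _ _ _) parallel_coset_at.
by exists (inr (coset_at i 0)) => //; apply: imset_f.
Qed.

Lemma translations_transitive : [transitive N, on [set inl p | p : point Ds] | to].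
Proof.
apply/imsetP; exists (inl 0); first exact: imset_f.
apply/setP=> x; apply/imsetP/imsetP=> [[v _ ->]|[_ /imsetP[u _ ->] ->]].
  by exists (translation v); rewrite ?translation_in // act_point permE addr0.
by exists (u + 0); rewrite // act_point permE.
Qed.

(** * Moving one direction: the action of [G] on blocks and on incident pairs *)

Hypothesis M_orbit : [transitive G0, on space_family M | 'P^*].

Lemma space_family_in i : vset (M i) \in space_family M.
Proof. exact: imset_f. Qed.

Lemma G0_maps i j : exists2 g, g \in G0 & maps_space g (M i) (M j).
Proof.
have [g G0g Eg] := atransP2 M_orbit (space_family_in i) (space_family_in j).
by exists g => //; apply: maps_spaceP.
Qed.

Lemma G0_maps_some g i : g \in G0 -> exists j, maps_space g (M i) (M j).
Proof.
move=> G0g; have : 'P^*%act (vset (M i)) g \in space_family M.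
  by rewrite -(atransP M_orbit _ (space_family_in i)); apply: mem_orbit.
by case/imsetP=> j _ /maps_spaceP; exists j.
Qed.

Lemma G_sub_dom : G \subset coset_dom M.
Proof.
apply/subsetP=> g /affine_permP[u [h G0h ->]]; apply: mem_coset_dom => B.
have [i [v ->]] := coset_at_surj B; have [j hij] := G0_maps_some i G0h.
by rewrite (affine_perm_coset _ _ _ (G0_linear G0h) hij) coset_in_all_cosets.
Qed.

Lemma act_affine_perm g a b i j v : g \in G0 -> maps_space g (M i) (M j) ->
  to (inr (coset_at i v)) (affine_perm g a b) = inr (coset_at j (b + g (v - a))).
Proof.
move=> G0g gij; apply: act_block; last exact: affine_perm_coset (G0_linear G0g) gij.
exact: (subsetP G_sub_dom) (affine_perm_in _ _ G0g).
Qed.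

Lemma affine_perm_base g a b : g \in G0 -> affine_perm g a b a = b.
Proof. by move=> G0g; rewrite affine_permE subrr linear_perm0 // addr0. Qed.

Lemma act_affine_perm_base g a b i j : g \in G0 -> maps_space g (M i) (M j) ->
  to (inr (coset_at i a)) (affine_perm g a b) = inr (coset_at j b).
Proof.
by move=> G0g gij; rewrite (act_affine_perm _ _ _ G0g gij) subrr linear_perm0 // addr0.
Qed.

Lemma transitive_incident : transitive_on_pairs to G inl inr (@incident Ds).
Proof.
move=> v B v' B'.
have [i [a ->]] := coset_at_surj B; have [i' [a' ->]] := coset_at_surj B'.
move=> /coset_at_incident-> /coset_at_incident->.
have [g G0g gii'] := G0_maps i i'; exists (affine_perm g v v').
  exact: affine_perm_in.
by rewrite (act_affine_perm_base _ _ G0g gii') act_point affine_perm_base.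
Qed.

(** * Moving two directions: intersecting blocks, the constant [mu] and connectedness *)

Hypothesis M_2trans : [transitive^2 G0, on space_family M | 'P^*].

Lemma G0_maps2 i j k l : i != j -> k != l ->
  exists2 g, g \in G0 & maps_space g (M i) (M k) /\ maps_space g (M j) (M l).
Proof.
(* 2-transitivity concerns pairs of distinct subspaces; [M_inj] provides them from distinct
   indices. *)
have dtu m n : m != n -> [tuple vset (M m); vset (M n)] \in 2.-dtuple(space_family M).
  move=> ne_mn; rewrite inE /= inE (inj_eq vset_M_inj) ne_mn /=.
  apply/subsetP=> X; rewrite !inE => /orP[] /eqP->; exact: space_family_in.
move=> /dtu ij /dtu kl; have [g G0g] := atransP2 M_2trans ij kl.
by case=> /esym/maps_spaceP gik /esym/maps_spaceP gjl; exists g.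
Qed.

Variables i1 i2 : 'I_r.
Hypothesis i1_neq_i2 : i1 != i2.
Hypothesis V_sum : fullv = (M i1 + M i2)%VS.

(** The decomposition is given for [i1] and [i2] only: pull [v] back along an element carrying that
    pair to [i], [j], split it there and push the summands forward. *)
Lemma add_spaces i j v : i != j -> exists2 u, u \in M i & v - u \in M j.
Proof.
move=> ne_ij; have [g G0g [g1 g2]] := G0_maps2 i1_neq_i2 ne_ij.
have : (g^-1)%g v \in (M i1 + M i2)%VS by rewrite -V_sum memvf.
case/memv_addP=> a Ma [b Mb Eab]; exists (g a); first by rewrite g1.
have <- : g b = v - g a; last by rewrite g2.
rewrite -[v in RHS](permKV g) Eab -(zmod_morphism_linear (G0_linear G0g)).
by rewrite addrC addKr.
Qed.

Lemma cosets_meet i j v w : i != j ->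
  exists x, @incident Ds x (coset_at i v) && @incident Ds x (coset_at j w).
Proof.
case/(@add_spaces i j (w - v))=> u Mu Mwvu; exists (v + u).
rewrite !incident_coset_at addrC addKr Mu -memvN opprB.
by rewrite opprD addrA.
Qed.

Lemma collinearP v w :
  reflect (v != w /\ exists i, w - v \in M i) (@collinear Ds v w).
Proof.
apply: (iffP andP) => -[ne_vw].
  case/existsP=> B; have [i [a ->]] := coset_at_surj B => /andP[/coset_at_incident->].
  by rewrite incident_coset_at; split; last by exists i.
case=> i Mi; split=> //; apply/existsP; exists (coset_at i v).
by rewrite !incident_coset_at subrr mem0v.
Qed.

Lemma noncollinearE v w :
  @noncollinear Ds v w = (v != w) && [forall i, w - v \notin M i].
Proof.
rewrite /noncollinear; congr (_ && _).
apply/negP/forallP => [no_B i | no_i /existsP[B]].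
  apply/negP=> Mi; case: no_B; apply/existsP; exists (coset_at i v).
  by rewrite !incident_coset_at subrr mem0v.
have [i [a ->]] := coset_at_surj B => /andP[/coset_at_incident->].
by rewrite incident_coset_at; apply/negP.
Qed.

(** Blocks of different directions meet by [cosets_meet], so only distinct parallel blocks
    remain. *)
Lemma nonintersectingP (B C : coset_block M) : @nonintersecting Ds B C ->
  exists i v w, [/\ B = coset_at i v, C = coset_at i w & w - v \notin M i].
Proof.
have [i [v ->]] := coset_at_surj B; have [j [w ->]] := coset_at_surj C.
have [<-|ne_ij] := eqVneq i j; last first.
  by case/andP=> _ /existsP[]; apply: cosets_meet.
case/andP=> ne_BC _; exists i, v, w; split=> //; apply: contra ne_BC => Miwv.
by apply/eqP/coset_at_eqP; rewrite -memvN opprB.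
Qed.

(** A common point becomes the representative of both blocks; equal directions would then make the
    blocks equal. *)
Lemma intersectingP (B C : coset_block M) :
  reflect (exists i j v, [/\ i != j, B = coset_at i v & C = coset_at j v])
          (@intersecting Ds B C).
Proof.
apply: (iffP andP) => [[ne_BC /existsP[x]] | [i [j [v [ne_ij -> ->]]]]].
  have [i [v EB]] := coset_at_surj B; have [j [w EC]] := coset_at_surj C.
  rewrite EB EC in ne_BC *; case/andP=> Bx Cx; exists i, j, x.
  rewrite (coset_at_incident Bx) (coset_at_incident Cx) in ne_BC *.
  by split=> //; apply: contra ne_BC => /eqP->.
split; first by apply: contra ne_ij => /eqP/coset_at_inj->.
by apply/existsP; exists v; rewrite !incident_coset_at subrr !mem0v.
Qed.

Lemma transitive_intersecting : transitive_on_pairs to G inr inr (@intersecting Ds).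
Proof.
move=> B C B' C' /intersectingP[i [j [v [ne_ij -> ->]]]].
case/intersectingP=> i' [j' [v' [ne_ij' -> ->]]].
have [g G0g [gi gj]] := G0_maps2 ne_ij ne_ij'; exists (affine_perm g v v').
  exact: affine_perm_in.
by rewrite (act_affine_perm_base _ _ G0g gi) (act_affine_perm_base _ _ G0g gj).
Qed.

Lemma translations_nicely_affine : nicely_affine to N.
Proof.
split; [exact: design_action_automorphisms translations_sub_dom
       | exact: translations_transitive | ].
(* The constant [mu] is read off from one reference pair, the blocks [M i1] and [M i2] through the
   origin. *)
exists #|[set p | @incident Ds p (coset_at i1 0) && @incident Ds p (coset_at i2 0)]|.
move=> B C ne_BC; have [i [v EB]] := coset_at_surj B; have [j [w EC]] := coset_at_surj C.
have -> : @parallel Ds _ _ to N B C = (i == j) by rewrite EB EC parallel_coset_at.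
case: eqP => [Eij|/eqP ne_ij].
  (* Parallel blocks sharing [x] would both be the coset through [x]. *)
  apply: eq_card0 => x; rewrite inE; apply: contraNF ne_BC => /andP[].
  by rewrite EB EC -Eij => /coset_at_incident-> /coset_at_incident->.
have X1 : @intersecting Ds (coset_at i1 0) (coset_at i2 0).
  by apply/intersectingP; exists i1, i2, 0.
have X2 : @intersecting Ds B C.
  by rewrite /intersecting ne_BC EB EC; apply/existsP; apply: cosets_meet.
(* An automorphism carrying the reference pair to [B], [C] maps the common points bijectively. *)
have [g Gg [gB gC]] := transitive_intersecting X1 X2.
have [_ _ _ incG] := design_action_automorphisms G_sub_dom.
rewrite -[RHS](card_imset _ (@perm_inj _ g)); apply: eq_card => x.
rewrite -(permKV g x); set y := _ x.
rewrite mem_imset ?inE; last exact: perm_inj.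
have act_y := act_point g y.
by congr (_ && _); [apply: incG act_y gB | apply: incG act_y gC].
Qed.

Lemma coset_design_connected : connected_graph (@edge (incidence_graph Ds)).
Proof.
set e := edge (b := _).
(* Three edges suffice: the coset through [v] in a direction other than that of [B] meets [B] in
   some [x]. *)
have to_block v (B : coset_block M) : connect e (inl v) (inr B).
  have [i [w ->]] := coset_at_surj B.
  have [j ne_ij] : exists j, j != i.
    case: (eqVneq i1 i) => [<-|]; last by exists i1.
    by exists i2; rewrite eq_sym.
  have [x /andP[vx xB]] := cosets_meet v w ne_ij.
  apply: (@connect_trans _ _ (inr (coset_at j v))).
    apply: connect1; rewrite -[e _ _]/(@incident Ds v (coset_at j v)).
    by rewrite incident_coset_at subrr mem0v.
  by apply: (@connect_trans _ _ (inl x)); apply: connect1.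
have sym_e : connect_sym e by apply: sym_connect_sym; apply: edge_sym.
move=> [v|B] [w|C] //.
- by apply: connect_trans (to_block v (coset_at i1 0)) _; rewrite sym_e.
- by rewrite sym_e.
by apply: connect_trans (to_block 0 C); rewrite sym_e.
Qed.

(** * Non-zero classes modulo [M i]: points off a block and parallel blocks *)

Hypothesis quot_trans :
  [transitive 'N_G0(vset (M i1) | 'P), on nonzero_quot (M i1) | 'P^*].

(** Transitivity on [nonzero_quot (M i1)] includes that this set is non-empty. *)
Lemma M_proper : exists v, v \notin M i1.
Proof.
have /imsetP[_ /imsetP[v nv ->] _] := quot_trans.
by exists v; rewrite !inE in nv.
Qed.

Lemma G0_maps_quot1 v w : v \notin M i1 -> w \notin M i1 ->
  exists2 g, g \in G0 & maps_space g (M i1) (M i1) /\ g v - w \in M i1.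
Proof.
move=> nv nw; have Q u : u \notin M i1 -> coset_of_space (M i1) u \in nonzero_quot (M i1).
  by move=> nu; apply: imset_f; rewrite !inE.
have [g /setIP[G0g stab_g] Eg] := atransP2 quot_trans (Q v nv) (Q w nw).
exists g => //; split; first by apply: maps_spaceP; apply: astabs_setact.
rewrite -mem_coset_of_space Eg; apply: (mem_setact 'P).
by rewrite mem_coset_of_space subrr mem0v.
Qed.

(** Since [quot_trans] speaks of [i1] only, carry direction [i] to [i1], match the classes there,
    then carry [i1] to [j]. *)
Lemma G0_maps_quot i j v w : v \notin M i -> w \notin M j ->
  exists2 g, g \in G0 & maps_space g (M i) (M j) /\ g v - w \in M j.
Proof.
move=> nv nw; have [g G0g gi] := G0_maps i i1; have [h G0h hj] := G0_maps i1 j.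
have ngv : g v \notin M i1 by rewrite gi.
have nhw : (h^-1)%g w \notin M i1 by rewrite -hj permKV.
have [k G0k [k1 kvw]] := G0_maps_quot1 ngv nhw.
exists (g * k * h)%g; first by rewrite !groupM.
split; first exact: maps_space_comp (maps_space_comp gi k1) hj.
rewrite !permM -[w](permKV h) -(zmod_morphism_linear (G0_linear G0h)).
by rewrite hj.
Qed.

(** Seen from the base point [v], the block is a direction with the class of [a - v], which is
    non-zero exactly when [v] is off the block. *)
Lemma transitive_nonincident :
  transitive_on_pairs to G inl inr
    (fun (v : point Ds) (B : coset_block M) => ~~ @incident Ds v B).
Proof.
move=> v B v' B'.
have [i [a ->]] := coset_at_surj B; have [i' [a' ->]] := coset_at_surj B'.
rewrite !incident_coset_at -memvN opprB -[v' - _ \in _]memvN opprB => ni ni'.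
have [g G0g [gii' gM]] := G0_maps_quot ni ni'.
exists (affine_perm g v v'); first exact: affine_perm_in.
rewrite act_point affine_perm_base // (act_affine_perm _ _ _ G0g gii').
split=> //; congr inr; apply/coset_at_eqP.
by rewrite -addrA [_ + - a']addrC addrA addrC -[v' - a']opprB in gM *.
Qed.

(** With [v] as base point, two distinct parallel blocks amount to a direction [i] and the non-zero
    class of [w - v] modulo [M i]. *)
Lemma transitive_nonintersecting :
  transitive_on_pairs to G inr inr (@nonintersecting Ds).
Proof.
move=> B C B' C' /nonintersectingP[i [v [w [-> -> ni]]]].
case/nonintersectingP=> i' [v' [w' [-> -> ni']]].
have [g G0g [gii' gM]] := G0_maps_quot ni ni'.
exists (affine_perm g v v'); first exact: affine_perm_in.
rewrite (act_affine_perm_base _ _ G0g gii') (act_affine_perm _ _ _ G0g gii').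
split=> //; congr inr; apply/coset_at_eqP.
by rewrite opprB addrCA addrA in gM *.
Qed.

(** Two distinct parallel blocks have no common point, which excludes walks of length 0 and 2;
    parity excludes 1 and 3. *)
Lemma incidence_graph_diameter : diameter_geq (@edge (incidence_graph Ds)) 4.
Proof.
have [v nv] := M_proper.
exists (inr (coset_at i1 0)), (inr (coset_at i1 v)) => j lt_j4.
apply/negP=> xy; have /= := walk_parity xy.
have no_pt x : @incident Ds x (coset_at i1 0) -> ~ @incident Ds x (coset_at i1 v).
  rewrite !incident_coset_at subr0 => Mx Mxv.
  by case/negP: nv; rewrite -[v](subKr x) memvB.
case: j lt_j4 xy => [|[|[|[|j]]]] // _.
  rewrite walk0 => /eqP[E] _.
  apply: (no_pt 0); first by rewrite incident_coset_at subrr mem0v.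
  have <- : coset_at i1 0 = coset_at i1 v by apply: val_inj.
  by rewrite incident_coset_at subrr mem0v.
rewrite walkS => /existsP[[x|?] /andP[//= x0]]; rewrite walkS.
case/existsP=> [[?|B] /andP[//= xB]]; rewrite walk0 => /eqP[EB] _.
by apply: (no_pt x) => //; move: xB; rewrite EB.
Qed.

(** * Collinear and non-collinear points, through orbits of [G0] on difference vectors *)

Hypothesis union_orbit :
  [transitive G0, on \bigcup_(i < r) nonzero (M i) | 'P].

Lemma mem_union v : (v \in \bigcup_(i < r) nonzero (M i)) =
  (v != 0) && [exists i, v \in M i].
Proof.
apply/bigcupP/andP => [[i _]|[v0 /existsP[i Miv]]].
  by rewrite inE => /andP[Miv v0]; split=> //; apply/existsP; exists i.
by exists i => //; rewrite inE Miv v0.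
Qed.

(** The difference of two collinear points lies in the union of the [nonzero (M i)], a single orbit
    of [G0]. *)
Lemma transitive_collinear : transitive_on_pairs to G inl inl (@collinear Ds).
Proof.
have un v w : collinear (Ds := Ds) v w -> w - v \in \bigcup_(i < r) nonzero (M i).
  case/collinearP=> ne_vw [i Mi]; rewrite mem_union subr_eq0 eq_sym ne_vw.
  by apply/existsP; exists i.
move=> v w v' w' /un vw /un vw'.
have [g G0g Eg] := atransP2 union_orbit vw vw'.
exists (affine_perm g v v'); first exact: affine_perm_in.
rewrite !act_point affine_perm_base // affine_permE.
by have <- : w' - v' = g (w - v) by []; rewrite addrC subrK.
Qed.

Hypothesis rank_G : has_rank G 2 \/ has_rank G 3.

(* The orbits of [G0] on [V] include [{0}] and the union of the [M i]^*, so
   rank at most 3 leaves at most one further orbit. *)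
Lemma G0_transitive_outside v w :
  (forall i, v \notin M i) -> (forall i, w \notin M i) ->
  exists2 g, g \in G0 & g v = w.
Proof.
move=> nv nw; have /imsetP[x Ux _] := union_orbit.
move: Ux; rewrite mem_union => /andP[x0 /existsP[i Mx]].
pose O u := orbit 'P 'C_G[0 | 'P]%g u.
have Oin a b : O a = O b -> exists2 g, g \in G0 & g a = b.
  move=> eqO; have /imsetP[g Cg ->] : b \in O a by rewrite eqO orbit_refl.
  by exists g => //; apply: stab0_linear.
have O0 a : a != 0 -> O 0 != O a.
  move=> a0; apply/eqP=> /Oin[g G0g]; rewrite linear_perm0 // => a_0.
  by rewrite -a_0 eqxx in a0.
have Ox a : (forall j, a \notin M j) -> O x != O a.
  move=> na; apply/eqP=> /Oin[g G0g gx]; have [j gij] := G0_maps_some i G0g.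
  by have := na j; rewrite -gx gij Mx.
have nz a : (forall j, a \notin M j) -> a != 0.
  by move=> na; apply: contraNneq (na i1) => ->; apply: mem0v.
apply: Oin; apply/eqP; apply: contraT => Ovw.
have uniqO : uniq [:: O 0; O x; O v; O w].
  by rewrite /= !inE !negb_or (O0 x) // (O0 v (nz v nv)) (O0 w (nz w nw)) Ox // Ox // Ovw.
pose orbits := [set O u | u in [set: V]].
have /(uniq_leq_size uniqO) : {subset [:: O 0; O x; O v; O w] <= enum orbits}.
  by move=> X; rewrite mem_enum !inE => /or4P[] /eqP->; apply: imset_f.
by rewrite -cardE /=; case: rank_G => -[_ /(_ 0) ->].
Qed.

Lemma transitive_noncollinear : transitive_on_pairs to G inl inl (@noncollinear Ds).
Proof.
move=> v w v' w'; rewrite !noncollinearE => /andP[_ /forallP n] /andP[_ /forallP n'].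
have [g G0g Eg] := G0_transitive_outside n n'.
exists (affine_perm g v v'); first exact: affine_perm_in.
by rewrite !act_point affine_perm_base // affine_permE Eg addrC subrK.
Qed.

Lemma coset_design_pairwise_transitive : pairwise_transitive to G.
Proof.
split; first exact: design_action_automorphisms G_sub_dom.
split; last first.
  by split; [exact: transitive_intersecting | exact: transitive_nonintersecting].
split; [exact: transitive_incident | exact: transitive_nonincident |
        exact: transitive_collinear | exact: transitive_noncollinear].
Qed.

Lemma translations_nontrivial : N :!=: 1%g.
Proof.
have [v nv] := M_proper; apply/eqP=> N1.
have : translation v \in (1%g : {set {perm V}}) by rewrite -N1 translation_in.
rewrite inE => /eqP/permP/(_ 0); rewrite permE perm1 addr0 => v0.
by rewrite v0 mem0v in nv.
Qed.

End CosetDesign.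

Theorem theorem1p7 (p d r : nat)
    (G0 G : {group {perm 'rV['F_p]_d}})
    (M : 'I_r -> {vspace 'rV['F_p]_d}) (i1 i2 : 'I_r)
    (p_prime : prime p)
    (G0_linear : linear_group G0)
    (G_def : G :=: (translations 'F_p d * G0)%g)
    (rank_G : has_rank G 2 \/ has_rank G 3)
    (r_ge3 : (3 <= r)%N)
    (M_inj : injective M)
    (M_orbit : [transitive G0, on space_family M | 'P^*])
    (M_2trans : [transitive^2 G0, on space_family M | 'P^*])
    (i1_neq_i2 : i1 != i2)
    (V_sum : fullv = (M i1 + M i2)%VS)
    (quot_trans :
      [transitive 'N_G0(vset (M i1) | 'P), on nonzero_quot (M i1) | 'P^*])
    (union_orbit : [transitive G0, on \bigcup_(i < r) nonzero (M i) | 'P]) :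
  let N := translations_group 'F_p d in
  let D := coset_design M in
  let Gamma := incidence_graph D in
  let to := coset_design_action M in
  [/\ design_automorphism_group to G,
      graph_automorphism_group (@edge Gamma) to G,
      connected_graph (@edge Gamma) &
      N :!=: 1%g /\ (N <| G)%g] /\
  (starlike (Gm := Gamma) to N r /\
   locally_distance_transitive (@edge Gamma) to G 4) /\
  (D = adjacency_design Gamma /\
   pairwise_transitive to G /\
   nicely_affine to N /\
   #|parallel_classes to N| = r).
Proof.
move=> N D Gamma to.
have autG := design_action_automorphisms (G_sub_dom G0_linear G_def M_orbit).
have autN := design_action_automorphisms (translations_sub_dom M).
have conn := coset_design_connected G0_linear M_inj M_2trans i1_neq_i2 V_sum.
have pt := coset_design_pairwise_transitive G0_linear G_def M_inj M_orbit
  M_2trans i1_neq_i2 V_sum quot_trans union_orbit rank_G.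
have affN := translations_nicely_affine G0_linear G_def M_inj M_orbit M_2trans
  i1_neq_i2 V_sum.
have classes := card_parallel_classes M_inj.
(* The equality [D = adjacency_design Gamma] holds by computation, as an edge from [inl] to [inr]
   reduces to incidence. *)
split; last split; last by [].
- split=> //; first exact: incidence_graph_automorphism_group.
  split; first exact: translations_nontrivial quot_trans.
  exact: translations_normal G_def.
- split; last first.
    exact: pairwise_locally_distance_transitive pt (incidence_graph_diameter quot_trans).
  split=> //; first exact: incidence_graph_automorphism_group autN.
    by apply: leq_trans r_ge3.
  exact: translations_transitive.
Qed.
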